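(* There is an algorithm that solves the FIFO Stack-Up problem in time $O(n!\cdot n^2)$; in particular, the problem is fixed-parameter tractable with respect to the number $n$ of bins.
   Context: FIFO Stack-Up problem. An instance consists of a list $Q=(q_1,\ldots,q_k)$ of sequences of pairwise distinct bins, a pallet symbol ${\it plt}(b)$ (a positive integer) for every bin $b$, and a positive integer $p$. Standing assumption: every pallet symbol that occurs is carried by at least two bins. $n$ is the total number of bins. A configuration is a tuple $(i_1,\ldots,i_k)$ with $0\le i_j\le |q_j|$, meaning that the first $i_j$ bins of $q_j$ have been removed. A pallet $t$ is open in configuration $(i_1,\ldots,i_k)$ if there are indices $j,\ell$ such that some bin for $t$ is at a position $\le i_j$ in $q_j$ and some bin for $t$ is at a position $> i_\ell$ in $q_\ell$. A transformation step removes the bin at position $i_j+1$ of some sequence $q_j$ (with $i_j<|q_j|$). A processing of $Q$ is a sequence of transformation steps from $(0,\ldots,0)$ to $(|q_1|,\ldots,|q_k|)$. The question is whether there is a processing of $Q$ such that in each configuration during the processing at most $p$ pallets are open. *)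

(* Defs.v *)
From mathcomp Require Import all_boot.

Set Implicit Arguments.
Unset Strict Implicit.
Unset Printing Implicit Defensive.

(* Unit-cost random-access machine over the natural numbers.  Addition and
   truncated subtraction are the only arithmetic operations: without
   multiplication, a run of length t lengthens the numbers it handles by at
   most t bits, so unit-cost time is polynomially related to Turing-machine
   time. *)

Inductive instr :=
| Const of nat & nat        (* Const r c : R[r] := c *)
| Add of nat & nat & nat    (* Add r s t : R[r] := R[s] + R[t] *)
| Sub of nat & nat & nat    (* Sub r s t : R[r] := R[s] - R[t], truncated *)
| Fetch of nat & nat        (* Fetch r s : R[r] := M[R[s]] *)
| Store of nat & nat        (* Store r s : M[R[r]] := R[s] *)
| Jump of nat               (* Jump l    : goto l *)
| Jz of nat & nat           (* Jz r l    : if R[r] = 0 then goto l *)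
| Halt.

Definition program := seq instr.

Record state := State { pc : nat; reg : nat -> nat; mem : nat -> nat }.

Definition upd (f : nat -> nat) (i v : nat) : nat -> nat :=
  fun j => if j == i then v else f j.

(* A program counter outside the program also halts. *)
Definition current (P : program) (s : state) : instr := nth Halt P (pc s).

Definition halted (P : program) (s : state) : bool :=
  if current P s is Halt then true else false.

Definition ram_step (P : program) (s : state) : state :=
  let R := reg s in
  let M := mem s in
  let next := (pc s).+1 in
  match current P s with
  | Const r c => State next (upd R r c) M
  | Add r a b => State next (upd R r (R a + R b)) M
  | Sub r a b => State next (upd R r (R a - R b)) M
  | Fetch r a => State next (upd R r (M (R a))) M
  | Store r a => State next R (upd M (R r) (R a))
  | Jump l => State l R M
  | Jz r l => State (if R r == 0 then l else next) R M
  | Halt => s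
  end.

Definition ram_init (x : seq nat) : state :=
  State 0 (fun=> 0) (fun i => nth 0 x i).

(* Halted states are fixed by [ram_step], so this says that [P] halts on input
   [x] after at most [t] steps; the output is read in register 0. *)
Definition outputs_within (P : program) (x : seq nat) (t v : nat) : Prop :=
  let s := iter t (ram_step P) (ram_init x) in halted P s /\ reg s 0 = v.

Definition computable (f : nat -> nat) : Prop :=
  exists P : program, forall n, exists t, outputs_within P [:: n] t (f n).

Definition decides_within (X : Type) (enc : X -> seq nat) (yes : X -> Prop)
    (P : program) (T : X -> nat) : Prop :=
  forall x, exists b : bool,
    (b <-> yes x) /\ outputs_within P (enc x) (T x) (nat_of_bool b).

Definition bitlen (m : nat) : nat := (trunc_log 2 m).+1.

Definition bitsize (x : seq nat) : nat := \sum_(m <- x) bitlen m.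

Definition fixed_parameter_tractable (X : Type) (enc : X -> seq nat)
    (yes : X -> Prop) (kappa : X -> nat) : Prop :=
  exists (P : program) (f : nat -> nat) (c : nat),
    computable f /\
    decides_within enc yes P (fun x => f (kappa x) * bitsize (enc x) ^ c).

(* Sequences may be empty, and so may the list of sequences; no bin occurs
   twice, neither within one sequence nor in two of them. *)
Record instance := Instance {
  bin : eqType;
  seqs : seq (seq bin);
  plt : bin -> nat;
  places : nat;
  bins_uniq : uniq (flatten seqs);
  plt_gt0 : forall b, b \in flatten seqs -> 0 < plt b;
  places_gt0 : 0 < places;
  plt_twice : forall b, b \in flatten seqs ->
    2 <= count (fun b' => plt b' == plt b) (flatten seqs)
}.

Definition nbins (I : instance) : nat := size (flatten (seqs I)).

Definition nseqs (I : instance) : nat := size (seqs I).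

Definition bseq (I : instance) (j : 'I_(nseqs I)) : seq (bin I) :=
  nth [::] (seqs I) j.

(* The bound [c j <= size (bseq j)] holds in the initial configuration and is
   preserved by [transform], so it is not built into the type. *)
Definition config (I : instance) := {ffun 'I_(nseqs I) -> nat}.

Definition init_config (I : instance) : config I := [ffun=> 0].

Definition final_config (I : instance) : config I :=
  [ffun j => size (bseq j)].

Definition transform (I : instance) : rel (config I) := fun c c' =>
  [exists j, (c j < size (bseq j)) &&
             (c' == [ffun l => if l == j then (c l).+1 else c l])].

Definition is_open (I : instance) (c : config I) (t : nat) : bool :=
  [exists j, exists l,
     has (fun b => plt b == t) (take (c j) (bseq j)) &&
     has (fun b => plt b == t) (drop (c l) (bseq l))].

Definition pallets (I : instance) : seq nat :=
  undup (map (@plt I) (flatten (seqs I))).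

Definition num_open (I : instance) (c : config I) : nat :=
  count (is_open c) (pallets I).

(* [s] lists the configurations reached after each step. *)
Definition processing (I : instance) (s : seq (config I)) : Prop :=
  path (@transform I) (init_config I) s /\
  last (init_config I) s = final_config I.

Definition fifo_stack_up (I : instance) : Prop :=
  exists s : seq (config I), processing s /\
    forall c, c \in init_config I :: s -> num_open c <= places I.

(* The number of bins, the number of sequences and the number of places,
   followed by a table of all bins, sequence by sequence and from front to
   back, giving for each bin the (0-based) index of its sequence and its pallet
   symbol.  Empty sequences have no entry in the table, so the length of the
   input depends on the number of bins only. *)
Definition encode (I : instance) : seq nat :=
  [:: nbins I; nseqs I; places I] ++
  flatten [seq [:: nat_of_ord j; plt b] | j <- enum 'I_(nseqs I), b <- bseq j].

(* Main.v *)
(* A configuration is recorded as the set of the removed bins, read as an n-bit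
   mask.  Its successors are larger numbers, so one pass over the masks in
   increasing order decides which configurations are reachable with at most p
   open pallets: a mask is good iff it is closed under predecessors within each
   sequence, opens at most p pallets, and some mask with one bit less is good.
   This takes O(2^n n^2) steps, and 2^n <= 2 n!.  For the parameterised claim,
   100 * 8^n is a computable bound on the same running time. *)

From mathcomp Require Import all_boot zify.
(* Loaded last because eqtype also exports a constant Sub. *)
Require Import Defs.

Set Implicit Arguments.
Unset Strict Implicit.
Unset Printing Implicit Defensive.

(** * Compiling loop programs to the machine *)

(** Jumps are reasoned about once, in a compiler for blocks and counted loops. A counted loop always
    ends, so [sem] is a total function and [cost] a sum; results and running time are then proved
    apart. The program is shown to fill a table [D] satisfying the recurrence [dp_step], a statement
    without instances, and the combinatorics concerns that recurrence only. Its crux is why dropping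
    a bit undoes a legal step: if the smaller mask is the removed set of a configuration, closure of
    the larger one forces the dropped bin to be the next of its sequence. Large numbers cost nothing
    extra at unit cost, so the parameterised bound needs no factor in the input length. *)

Inductive cmd :=
| Block of seq instr
| Seq of cmd & cmd
| Loop of nat & cmd.

Definition store := ((nat -> nat) * (nat -> nat))%type.

Definition exec (i : instr) (s : store) : store :=
  let s' := ram_step [:: i] (State 0 s.1 s.2) in (reg s', mem s').

Definition exec_seq (l : seq instr) (s : store) : store :=
  foldl (fun s i => exec i s) s l.

(* Register 1 holds the constant 1, which the loop counters need because the
   machine has no immediate operands. *)
Definition decr (r : nat) : seq instr := [:: Const 1 1; Sub r r 1].
Definition tick (r : nat) (s : store) : store := exec_seq (decr r) s.

(** A loop fixes its number of rounds on entry, whereas the compiled code tests the counter in every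
    round. The two agree because [wf] forbids the body to write the counter, and excludes register 1
    as counter, which [decr] overwrites. *)
Fixpoint sem (c : cmd) (s : store) : store :=
  match c with
  | Block l => exec_seq l s
  | Seq a b => sem b (sem a s)
  | Loop r a => iter (s.1 r) (fun s => sem a (tick r s)) s
  end.

(** Each round pays 4 for the test, the two instructions of [decr] and the jump back; the final 1 is
    the test that exits. *)
Fixpoint cost (c : cmd) (s : store) : nat :=
  match c with
  | Block l => size l
  | Seq a b => cost a s + cost b (sem a s)
  | Loop r a =>
    \sum_(k < s.1 r) (cost a (tick r
      (iter k (fun s => sem a (tick r s)) s)) + 4) + 1
  end.

Fixpoint csize (c : cmd) : nat :=
  match c with
  | Block l => size l
  | Seq a b => csize a + csize b
  | Loop r a => csize a + 4
  end.

Fixpoint compile (o : nat) (c : cmd) : program :=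
  match c with
  | Block l => l
  | Seq a b => compile o a ++ compile (o + csize a) b
  | Loop r a =>
    Jz r (o + csize a + 4) :: decr r ++ compile (o + 3) a ++ [:: Jump o]
  end.

Definition target (i : instr) : seq nat :=
  match i with
  | Const r _ | Add r _ _ | Sub r _ _ | Fetch r _ => [:: r]
  | _ => [::]
  end.

Fixpoint targets (c : cmd) : seq nat :=
  match c with
  | Block l => flatten (map target l)
  | Seq a b => targets a ++ targets b
  | Loop r a => [:: 1, r & targets a]
  end.

Definition straight (i : instr) : bool :=
  match i with Jump _ | Jz _ _ | Halt => false | _ => true end.

Fixpoint wf (c : cmd) : bool :=
  match c with
  | Block l => all straight l
  | Seq a b => wf a && wf b
  | Loop r a => [&& r != 1, r \notin targets a & wf a]
  end.

Lemma size_compile c o : size (compile o c) = csize c.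
Proof.
elim: c o => //= [a IHa b IHb|r a IHa] o; first by rewrite size_cat IHa IHb.
by rewrite size_cat IHa addn1 addn4.
Qed.

Lemma exec_frame i s r : r \notin target i -> (exec i s).1 r = s.1 r.
Proof.
by case: i => //= *; rewrite /exec /= /upd ifN //; rewrite -mem_seq1.
Qed.

Lemma exec_seq_frame l s r :
  r \notin flatten (map target l) -> (exec_seq l s).1 r = s.1 r.
Proof.
elim: l s => //= i l IHl s; rewrite mem_cat negb_or => /andP[ri rl].
by rewrite IHl // exec_frame.
Qed.

Lemma sem_frame c s r : r \notin targets c -> (sem c s).1 r = s.1 r.
Proof.
elim: c s => [l|a IHa b IHb|r' a IHa] s /=; first exact: exec_seq_frame.
  by rewrite mem_cat negb_or => /andP[ra rb]; rewrite IHb // IHa.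
rewrite !inE !negb_or => /and3P[r1 rr' ra].
elim: (s.1 r') => // k IHk; rewrite iterS IHa // exec_seq_frame //.
by rewrite !inE negb_or r1.
Qed.

Lemma loop_counter r a s k : r != 1 -> r \notin targets a -> k <= s.1 r ->
  (iter k (fun s => sem a (tick r s)) s).1 r = s.1 r - k.
Proof.
move=> r1 ra; elim: k => [|k IHk] kr; first by rewrite subn0.
rewrite iterS sem_frame // [LHS]/= /upd /= eqxx (negbTE r1) IHk 1?ltnW //.
by rewrite subn1 subnS.
Qed.

Lemma exec_step P i s o : straight i -> nth Halt P o = i ->
  ram_step P (State o s.1 s.2) = State o.+1 (exec i s).1 (exec i s).2.
Proof. by move=> si Pi; rewrite /ram_step /current /= Pi; case: i si {Pi}. Qed.

Lemma exec_seq_steps p l q s : all straight l ->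
  iter (size l) (ram_step (p ++ l ++ q)) (State (size p) s.1 s.2) =
  State (size p + size l) (exec_seq l s).1 (exec_seq l s).2.
Proof.
elim: l p s => [|i l IHl] p s /=; first by rewrite addn0.
case/andP=> si sl; rewrite -iterS iterSr (@exec_step _ i) //; last first.
  by rewrite nth_cat ltnn subnn.
by have := IHl (rcons p i) (exec i s) sl; rewrite cat_rcons size_rcons addnS.
Qed.

(** Jump targets are absolute, so the code runs at origin [size p] in arbitrary surroundings; the
    induction needs this form for a body inside a loop. *)
Lemma compile_steps p c q s : wf c ->
  iter (cost c s) (ram_step (p ++ compile (size p) c ++ q))
    (State (size p) s.1 s.2) =
  State (size p + csize c) (sem c s).1 (sem c s).2.
Proof.
elim: c p q s => [l|a IHa b IHb|r a IHa] p q s; first exact: exec_seq_steps.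
  move=> /= /andP[wa wb]; rewrite addnC iterD -!catA IHa //.
  have := IHb (p ++ compile (size p) a) q (sem a s) wb.
  by rewrite size_cat size_compile -!catA addnA.
move=> /= /and3P[r1 ra wa].
set P := p ++ _; set o := size p; pose F s := sem a (tick r s).
have Pjz : nth Halt P o = Jz r (o + csize a + 4).
  by rewrite /P nth_cat ltnn subnn.
have Pcat : P = (p ++ Jz r (o + csize a + 4) :: decr r) ++
    compile (o + 3) a ++ Jump o :: q by rewrite /P /= -!catA.
have size_pre : size (p ++ Jz r (o + csize a + 4) :: decr r) = o + 3.
  by rewrite size_cat.
have Pjmp : nth Halt P (o + csize a + 3) = Jump o.
  rewrite Pcat catA nth_cat size_cat size_pre size_compile addnAC.
  by rewrite ltnn subnn.
have loop k : k <= s.1 r ->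
    iter (\sum_(i < k) (cost a (tick r (iter i F s)) + 4))
      (ram_step P) (State o s.1 s.2) = State o (iter k F s).1 (iter k F s).2.
  elim: k => [|k IHk] kr; first by rewrite big_ord0.
  rewrite big_ord_recr /= addnC iterD IHk 1?ltnW //.
  set u := iter k F s; set v := tick r u.
  have u0 : (u.1 r == 0) = false.
    by rewrite loop_counter // 1?ltnW // subn_eq0 leqNgt kr.
  have -> : cost a v + 4 = 1 + (cost a v + (2 + 1)) by lia.
  rewrite iterD (iterD (cost a v)) (iterD 2).
  have jz1 : iter 1 (ram_step P) (State o u.1 u.2) = State o.+1 u.1 u.2.
    by rewrite /= /ram_step /current /= Pjz u0.
  rewrite jz1.
  have := @exec_seq_steps (rcons p (Jz r (o + csize a + 4))) (decr r)
    (compile (o + 3) a ++ Jump o :: q) u isT.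
  rewrite cat_rcons size_rcons -cat_cons catA -Pcat => ->.
  have := IHa (p ++ Jz r (o + csize a + 4) :: decr r) (Jump o :: q) v wa.
  rewrite size_pre -Pcat [size (decr r)]/= addSn -addnS => ->.
  by rewrite /= /ram_step /current /= addnAC Pjmp.
rewrite addnC iterD loop //=.
rewrite /ram_step /current /= Pjz loop_counter // subnn eqxx.
by rewrite addnA.
Qed.

Lemma halted_iter P s t t' : t <= t' -> halted P (iter t (ram_step P) s) ->
  iter t' (ram_step P) s = iter t (ram_step P) s.
Proof.
move=> tt' h; rewrite -(subnK tt') iterD; elim: (t' - t) => //= k ->.
by move: h; rewrite /halted /ram_step; case: (current _ _).
Qed.

Lemma outputs_compile c x t : wf c ->
  let s := (fun=> 0, fun i => nth 0 x i) in
  cost c s <= t ->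
  outputs_within (rcons (compile 0 c) Halt) x t ((sem c s).1 0).
Proof.
move=> wc s le_t; rewrite /outputs_within.
have steps := @compile_steps [::] c [:: Halt] s wc.
have h : halted (rcons (compile 0 c) Halt)
    (iter (cost c s) (ram_step (rcons (compile 0 c) Halt)) (ram_init x)).
  rewrite -cats1 [iter _ _ _]steps /halted /current /=.
  by rewrite nth_cat size_compile ltnn subnn.
by rewrite (halted_iter le_t h); split=> //; rewrite -cats1 [iter _ _ _]steps.
Qed.

(** The invariant [J] carries the register from which the body sets the counters of its inner
    loops. *)
Lemma loop_cost r a s (J : store -> Prop) T :
  (forall u, J u -> J (sem a (tick r u))) ->
  (forall u, J u -> cost a (tick r u) <= T) ->
  J s -> cost (Loop r a) s <= s.1 r * (T + 4) + 1.
Proof.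
move=> JS JT Js /=; rewrite leq_add2r -{6}[s.1 r]card_ord -sum_nat_const.
apply: leq_sum => k _; rewrite leq_add2r; apply: JT.
by elim: (k : nat) => //= i; apply: JS.
Qed.

(** * The algorithm *)

(** The step may assume that registers never written by the body keep their initial values, which
    keeps them out of every invariant. *)
Lemma loop_ind r a s (Inv : nat -> store -> Prop) :
  r != 1 -> r \notin targets a -> Inv 0 s ->
  (forall k u, k < s.1 r -> Inv k u ->
    (forall x, x \notin [:: 1, r & targets a] -> u.1 x = s.1 x) ->
    Inv k.+1 (sem a (tick r u))) ->
  Inv (s.1 r) (sem (Loop r a) s).
Proof.
move=> r1 ra Inv0 InvS /=; set f := fun _ => _.
have frame k x : x \notin [:: 1, r & targets a] -> (iter k f s).1 x = s.1 x.
  rewrite !inE !negb_or => /and3P[x1 xr xa]; elim: k => // k IHk.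
  by rewrite iterS sem_frame // exec_seq_frame // !inE negb_or x1.
have: forall k, k <= s.1 r -> Inv k (iter k f s).
  elim=> // k IHk kr; rewrite iterS; apply: InvS => //; first exact/IHk/ltnW.
  by move=> x; apply: frame.
exact.
Qed.

Definition bit (m i : nat) : bool := odd (m %/ 2 ^ i).

(** The absolute difference, since at least one of the truncated terms is zero; it serves as a test
    for equality. *)
Definition dist (a b : nat) := (a - b) + (b - a).

(* The tests below are arithmetic so that the program needs no branching:
   [1 - x] negates a flag, and a 0/1 term is cancelled by subtracting a number
   that is nonzero when the condition fails.  [s j] is the index of the sequence
   and [q j] the pallet symbol of bin [j], and [b] is the set of removed bins.
   A pallet is counted at its last bin, the one with [later n q i = 0]. *)
Definition later n (q : nat -> nat) i :=
  \sum_(j < n) ((1 - (1 - (j - i))) - dist (q i) (q j)).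

Definition differ n (q : nat -> nat) (b : nat -> bool) i :=
  \sum_(j < n) (dist (b i) (b j) - dist (q i) (q j)).

(** The table lists each sequence from front to back, so within a sequence a bin in front of [i] is
    one with a smaller index. *)
Definition disorder n (s : nat -> nat) (b : nat -> bool) i :=
  \sum_(j < n) ((b i - b j) - dist (s i) (s j) - (1 - (i - j))).

Definition opened n (q : nat -> nat) (b : nat -> bool) :=
  \sum_(i < n) ((1 - later n q i) - (1 - differ n q b i)).

(** Where bit [i] is clear, subtracting 1 cancels the term, because table entries are at most 1. The
    entry read there is meaningless, but still below a positive [x]. *)
Definition preds n (D : nat -> nat) x :=
  \sum_(i < n) (D (x - 2 ^ i) - (1 - bit x i)).

Definition dp_step n s q p (D : nat -> nat) x :=
  1 - (1 - preds n D x) - \sum_(i < n) disorder n s (bit x) i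
    - (opened n q (bit x) - p).

(* Memory: the input occupies 0 .. A-1 with A = 2n+3, the bits of the current
   mask A .. A+n-1, and the entry of the table for mask x is at D+x, D = A+n.
   Registers:
     1 the constant 1      2 n           3 A           4 D
     5 mask x              6 bin i       7 2^i         8 bit i of x
     9 sequence of i      10 pallet of i              12 bin j
    14 bit j of x         15 sequence of j
    16 carry of the increment of x; temporary         13, 17 temporaries
    18 later              19 differ     20 disorder   21 opened
    22 preds, then the new table entry  23, 24, 25 loop counters *)
Definition pair_scan : seq instr :=
  [:: Const 13 3; Add 13 13 12; Add 13 13 12; Fetch 15 13; Add 13 13 1;
      Fetch 17 13; Add 13 3 12; Fetch 14 13;
      Sub 16 10 17; Sub 17 17 10; Add 16 16 17;
      Sub 17 12 6; Sub 17 1 17; Sub 17 1 17; Sub 17 17 16; Add 18 18 17;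
      Sub 17 8 14; Sub 13 14 8; Add 17 17 13; Sub 17 17 16; Add 19 19 17;
      Sub 16 9 15; Sub 17 15 9; Add 16 16 17; Sub 17 8 14; Sub 17 17 16;
      Sub 16 6 12; Sub 16 1 16; Sub 17 17 16; Add 20 20 17; Add 12 12 1].

Definition row_start : seq instr :=
  [:: Const 13 3; Add 13 13 6; Add 13 13 6; Fetch 9 13; Add 13 13 1;
      Fetch 10 13; Add 13 3 6; Fetch 8 13;
      Const 18 0; Const 19 0; Const 12 0; Const 25 0; Add 25 25 2].

Definition row_end : seq instr :=
  [:: Const 1 1; Sub 16 1 18; Sub 17 1 19; Sub 16 16 17; Add 21 21 16;
      Sub 13 5 7; Add 13 4 13; Fetch 13 13; Sub 16 1 8; Sub 13 13 16;
      Add 22 22 13; Add 7 7 7; Add 6 6 1].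

Definition row : cmd :=
  Seq (Block row_start) (Seq (Loop 25 (Block pair_scan)) (Block row_end)).

(** With [t] the bit plus the carry, the new carry is [t - 1] and the new bit
    [t - (t - 1) - (t - 1)]; truncation makes [t = 0] come out right. *)
Definition carry_step : seq instr :=
  [:: Add 13 3 6; Fetch 14 13; Add 14 14 16; Sub 16 14 1; Sub 14 14 16;
      Sub 14 14 16; Store 13 14; Add 6 6 1].

Definition mask_start : seq instr :=
  [:: Add 5 5 1; Const 6 0; Const 24 0; Add 24 24 2; Const 16 1].

Definition mask_mid : seq instr :=
  [:: Const 20 0; Const 21 0; Const 22 0; Const 7 1; Const 6 0; Const 24 0;
      Add 24 24 2].

Definition mask_end : seq instr :=
  [:: Const 1 1; Const 13 2; Fetch 13 13; Sub 13 21 13; Sub 22 1 22;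
      Sub 22 1 22; Sub 22 22 20; Sub 22 22 13; Add 13 4 5; Store 13 22].

Definition mask : cmd :=
  Seq (Block mask_start) (Seq (Loop 24 (Block carry_step))
    (Seq (Block mask_mid) (Seq (Loop 24 row) (Block mask_end)))).

Definition start : seq instr :=
  [:: Const 1 1; Const 2 0; Fetch 2 2; Const 3 3; Add 3 3 2; Add 3 3 2;
      Add 4 3 2; Store 4 1; Const 5 0; Const 23 1; Const 6 0; Add 6 6 2].

(** [start] enters the empty mask as good, so [2 ^ n - 1] rounds remain, and register 5 ends at the
    full mask, whose entry is the answer. Repeated doubling supplies [2 ^ n]. *)
Definition algo : cmd :=
  Seq (Block start) (Seq (Loop 6 (Block [:: Add 23 23 23]))
    (Seq (Block [:: Const 1 1; Sub 23 23 1]) (Seq (Loop 23 mask)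
      (Block [:: Add 0 4 5; Fetch 0 0])))).

(** Register numbers are numerals, so running a block symbolically is mere conversion. *)
Lemma pair_scanE s (st := exec_seq pair_scan (tick 25 s))
  (R := s.1) (M := s.2)
  (j := R 12) (sj := M (3 + j + j)) (qj := M (3 + j + j + 1))
  (bj := M (R 3 + j)) :
  [/\ st.1 12 = j + 1,
   st.1 18 = R 18 + ((1 - (1 - (j - R 6))) - dist (R 10) qj),
   st.1 19 = R 19 + (dist (R 8) bj - dist (R 10) qj),
   st.1 20 = R 20 + ((R 8 - bj) - dist (R 9) sj - (1 - (R 6 - j))) &
   st.2 = M].
Proof. by split; reflexivity. Qed.

Definition table n (s q : nat -> nat) (M : nat -> nat) :=
  forall j, j < n -> M (3 + j + j) = s j /\ M (3 + j + j + 1) = q j.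

Definition bits n A (b : nat -> bool) (M : nat -> nat) :=
  forall j, j < n -> M (A + j) = b j.

Lemma pair_loop n s q b i (st : store) :
  table n s q st.2 -> bits n (st.1 3) b st.2 ->
  st.1 25 = n -> st.1 12 = 0 -> st.1 18 = 0 -> st.1 19 = 0 ->
  st.1 6 = i -> st.1 8 = b i -> st.1 9 = s i -> st.1 10 = q i ->
  let st' := sem (Loop 25 (Block pair_scan)) st in
  [/\ st'.1 18 = later n q i, st'.1 19 = differ n q b i,
      st'.1 20 = st.1 20 + disorder n s b i & st'.2 = st.2].
Proof.
move=> tab bts r25 r12 r18 r19 r6 r8 r9 r10.
have := @loop_ind 25 (Block pair_scan) st (fun k u =>
  [/\ u.1 12 = k, u.1 18 = later k q i, u.1 19 = differ k q b i,
      u.1 20 = st.1 20 + disorder k s b i & u.2 = st.2]).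
rewrite r25 => H; apply: (fun G => let: And5 _ a b c d := G in And4 a b c d).
apply: H => //.
  by rewrite /later /differ /disorder !big_ord0 addn0.
move=> k u kn [u12 u18 u19 u20 uM] fr.
rewrite [sem _ _]/(exec_seq pair_scan (tick 25 u)).
have [-> -> -> -> ->] := pair_scanE u.
have [Ms Mq] := tab k kn.
have [v3 v6 v8 v9 v10] : [/\ u.1 3 = st.1 3, u.1 6 = i, u.1 8 = b i,
  u.1 9 = s i & u.1 10 = q i] by split; rewrite fr.
rewrite u12 u18 u19 u20 v3 v6 v8 v9 v10 uM Ms Mq bts // addn1.
by rewrite /later /differ /disorder !big_ord_recr /= addnA.
Qed.

Lemma row_startE s (st := exec_seq row_start (tick 24 s))
  (R := s.1) (M := s.2) (i := R 6) :
  [/\ st.1 8 = M (R 3 + i), st.1 9 = M (3 + i + i),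
      st.1 10 = M (3 + i + i + 1) & st.1 25 = R 2] /\
  [/\ st.1 12 = 0, st.1 18 = 0, st.1 19 = 0 & st.2 = M].
Proof. by split; split; reflexivity. Qed.

Lemma row_start_frame s (st := exec_seq row_start (tick 24 s)) (R := s.1) :
  [/\ st.1 3 = R 3, st.1 6 = R 6 & st.1 20 = R 20].
Proof. by split; reflexivity. Qed.

Lemma row_endE s (st := exec_seq row_end s) (R := s.1) (M := s.2) :
  [/\ st.1 6 = R 6 + 1, st.1 7 = R 7 + R 7,
      st.1 21 = R 21 + ((1 - R 18) - (1 - R 19)),
      st.1 22 = R 22 + (M (R 4 + (R 5 - R 7)) - (1 - R 8)) & st.2 = M] /\
  st.1 20 = R 20.
Proof. by split; first split; reflexivity. Qed.

Lemma rows n s q (st : store) x (D := fun y => st.2 (st.1 4 + y)) :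
  table n s q st.2 -> bits n (st.1 3) (bit x) st.2 -> st.1 2 = n ->
  st.1 5 = x -> st.1 24 = n -> st.1 6 = 0 -> st.1 7 = 1 -> st.1 20 = 0 ->
  st.1 21 = 0 -> st.1 22 = 0 ->
  let st' := sem (Loop 24 row) st in
  [/\ st'.1 20 = \sum_(i < n) disorder n s (bit x) i,
      st'.1 21 = opened n q (bit x), st'.1 22 = preds n D x & st'.2 = st.2].
Proof.
move=> tab bts r2 r5 r24 r6 r7 r20 r21 r22.
have := @loop_ind 24 row st (fun k u =>
  [/\ u.1 6 = k, u.1 7 = 2 ^ k & u.2 = st.2] /\
  [/\ u.1 20 = \sum_(i < k) disorder n s (bit x) i,
      u.1 21 = \sum_(i < k) ((1 - later n q i) - (1 - differ n q (bit x) i)) &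
      u.1 22 = preds k D x]).
rewrite r24 => H.
apply: (fun G => let: conj (And3 _ _ d) (And3 a b c) := G in And4 a b c d).
apply: H => //.
  by rewrite /preds !big_ord0.
move=> k u kn [[u6 u7 uM] [u20 u21 u22]] fr.
have [v2 v3 v4 v5] : [/\ u.1 2 = n, u.1 3 = st.1 3, u.1 4 = st.1 4 & u.1 5 = x].
  by split; rewrite fr.
have -> : sem row (tick 24 u) = exec_seq row_end (sem (Loop 25
  (Block pair_scan)) (exec_seq row_start (tick 24 u))) by [].
have [[w8 w9 w10 w25] [w12 w18 w19 wM]] := row_startE u.
have [w3 w6 w20] := row_start_frame u.
have [Ms Mq] := tab k kn.
have frw r : r \notin [:: 1, 24 & flatten (map target row_start)] ->
    (exec_seq row_start (tick 24 u)).1 r = u.1 r.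
  rewrite 2!in_cons 2!negb_or => /and3P[r1' r24' rr].
  by rewrite exec_seq_frame // /tick exec_seq_frame // !inE negb_or r1' r24'.
have [w4 w5 w7 w21 w22] := And5 (frw 4 isT) (frw 5 isT) (frw 7 isT) (frw 21 isT)
  (frw 22 isT).
move: (exec_seq row_start _) w8 w9 w10 w25 w12 w18 w19 wM w3 w6 w20 w4 w5 w7 w21 w22.
move=> w w8 w9 w10 w25 w12 w18 w19 wM w3 w6 w20 w4 w5 w7 w21 w22 {frw}.
have := @pair_loop n s q (bit x) k w.
have zf r : r \notin targets (Loop 25 (Block pair_scan)) ->
  (sem (Loop 25 (Block pair_scan)) w).1 r = w.1 r by apply: sem_frame.
have [z4 z5 z6 z7 z8] := And5 (zf 4 isT) (zf 5 isT) (zf 6 isT) (zf 7 isT)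
  (zf 8 isT).
have [z21 z22] := conj (zf 21 isT) (zf 22 isT).
move: (sem (Loop 25 (Block pair_scan)) w) z4 z5 z6 z7 z8 z21 z22 {zf}.
move=> z z4 z5 z6 z7 z8 z21 z22.
rewrite wM w3 v3 w25 w6 w8 w9 w10 u6 v3 uM v2 bts //.
case=> // z18 z19 z20 zM.
have [[-> -> -> -> ->] ->] := row_endE z.
rewrite z18 z19 z20 zM z4 z5 z6 z7 z8 z21 z22 w4 w5 w6 w7 w8 w20 w21 w22.
rewrite v3 v4 v5 u6 u7 u20 u21 u22 uM bts //.
by rewrite addnn -mul2n -expnS addn1 /preds !big_ord_recr.
Qed.

(** When 1 is added to [m], the carry into position [i] is 1 exactly if the lower [i] bits of [m]
    are all set, that is, if [2 ^ i] divides [m.+1]. *)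
Lemma bit_succ m i (c := 2 ^ i %| m.+1) :
  bit m i + c - 1 = (2 ^ i.+1 %| m.+1) :> nat /\
  bit m i + c - (2 ^ i.+1 %| m.+1) - (2 ^ i.+1 %| m.+1) = bit m.+1 i.
Proof.
have p0 : 0 < 2 ^ i by rewrite expn_gt0.
rewrite /bit divnS // -/c oddD oddb.
have -> : (2 ^ i.+1 %| m.+1) = c && odd (m %/ 2 ^ i).
  case: (boolP c) => cE /=; last first.
    apply: contraNF cE; apply: dvdn_trans.
    by rewrite expnS dvdn_mull.
  have : m.+1 %/ 2 ^ i = (m %/ 2 ^ i).+1 by rewrite divnS // -/c cE.
  rewrite -{2}(divnK cE) => ->.
  by rewrite expnS dvdn_pmul2r // dvdn2 /= negbK.
by case: c; case: (odd _).
Qed.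

Lemma carry_stepE s (st := exec_seq carry_step (tick 24 s))
  (R := s.1) (M := s.2) (a := R 3 + R 6) (t := M a + R 16) :
  [/\ st.1 6 = R 6 + 1, st.1 16 = t - 1 &
      st.2 = upd M a (t - (t - 1) - (t - 1))].
Proof. by split; reflexivity. Qed.

Lemma carry_loop n m (st : store) (A := st.1 3) :
  bits n A (bit m) st.2 -> st.1 24 = n -> st.1 6 = 0 -> st.1 16 = 1 ->
  let st' := sem (Loop 24 (Block carry_step)) st in
  bits n A (bit m.+1) st'.2 /\
  forall x, (x < A) || (A + n <= x) -> st'.2 x = st.2 x.
Proof.
move=> bts r24 r6 r16.
have := @loop_ind 24 (Block carry_step) st (fun k u =>
  [/\ u.1 6 = k, u.1 16 = (2 ^ k %| m.+1),
      forall j, j < n -> u.2 (A + j) = if j < k then bit m.+1 j else bit m j &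
      forall x, (x < A) || (A + n <= x) -> u.2 x = st.2 x]).
rewrite r24 => H.
have [||_ _ b fM] := H isT isT; last by split=> // j jn; rewrite b // jn.
- by split=> //; rewrite r16 dvd1n.
- move=> k u kn [u6 u16 ub uM] fr; rewrite -/A.
  have -> : sem (Block carry_step) (tick 24 u) =
    exec_seq carry_step (tick 24 u) by [].
  have [-> -> ->] := carry_stepE u.
  have v3 : u.1 3 = A by rewrite fr.
  rewrite u6 u16 v3 ub // ltnn; have [-> ->] := bit_succ m k.
  split=> // [|j jn|x xA]; first by rewrite addn1.
    rewrite /upd eqn_add2l ltnS leq_eqVlt; case: eqP => [->//|_] /=.
    exact: ub.
  rewrite /upd; case: eqP => [xE|_]; last exact: uM.
  by move: xA; rewrite xE; lia.
Qed.

(** Only entries below [x] are read, so later writes do not invalidate the recurrence at [x], and it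
    can be stated for the final table. *)
Lemma dp_step_ext n s q p D D' x : 0 < x -> (forall y, y < x -> D y = D' y) ->
  dp_step n s q p D x = dp_step n s q p D' x.
Proof.
move=> x0 DD; rewrite /dp_step /preds; congr (1 - (1 - _) - _ - _).
by apply: eq_bigr => i _; rewrite DD // ltn_subrL expn_gt0.
Qed.

Lemma mask_startE s (st := exec_seq mask_start (tick 23 s))
  (R := s.1) :
  [/\ st.1 3 = R 3, st.1 6 = 0, st.1 16 = 1, st.1 24 = R 2 & st.2 = s.2] /\
  st.1 5 = R 5 + 1.
Proof. by split; first split; reflexivity. Qed.

Lemma mask_midE s (st := exec_seq mask_mid s) (R := s.1) :
  [/\ st.1 20 = 0, st.1 21 = 0, st.1 22 = 0, st.1 7 = 1 & st.1 6 = 0] /\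
  [/\ st.1 24 = R 2, st.1 2 = R 2, st.1 3 = R 3, st.1 4 = R 4 & st.1 5 = R 5]
  /\ st.2 = s.2.
Proof. by split; first split; try reflexivity; split; first split; reflexivity. Qed.

Lemma mask_endE s (st := exec_seq mask_end s) (R := s.1) :
  st.1 5 = R 5 /\
  st.2 = upd s.2 (R 4 + R 5) (1 - (1 - R 22) - R 20 - (R 21 - s.2 2)).
Proof. by split; reflexivity. Qed.

Lemma masks n s q p (st : store) N
  (A := 3 + n + n) (D0 := A + n) (st' := sem (Loop 23 mask) st) :
  table n s q st.2 -> bits n A (bit 0) st.2 -> st.2 2 = p -> st.2 D0 = 1 ->
  st.1 2 = n -> st.1 3 = A -> st.1 4 = D0 -> st.1 5 = 0 -> st.1 23 = N ->
  [/\ st'.1 5 = N, st'.2 D0 = 1 & forall x, 0 < x <= N ->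
      st'.2 (D0 + x) = dp_step n s q p (fun y => st'.2 (D0 + y)) x].
Proof.
move=> tab bts p2 d1 r2 r3 r4 r5 r23.
have := @loop_ind 23 mask st (fun k u =>
  [/\ u.1 5 = k, table n s q u.2, bits n A (bit k) u.2 & u.2 2 = p] /\
  [/\ u.2 D0 = 1 & forall x, 0 < x <= k ->
      u.2 (D0 + x) = dp_step n s q p (fun y => u.2 (D0 + y)) x]).
rewrite r23 => H.
apply: (fun G => let: conj (And4 a _ _ _) (conj b c) := G in And3 a b c).
apply: H => //.
  split=> //; split=> // x; case/andP=> x0; by rewrite leqNgt x0.
move=> k u kN [[u5 utab ubts up] [ud1 udp]] fr.
have [v2 v3 v4] : [/\ u.1 2 = n, u.1 3 = A & u.1 4 = D0].
  by split; rewrite fr.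
have -> : sem mask (tick 23 u) = exec_seq mask_end (sem (Loop 24 row)
  (exec_seq mask_mid (sem (Loop 24 (Block carry_step))
  (exec_seq mask_start (tick 23 u))))) by [].
have := mask_startE u.
have : (exec_seq mask_start (tick 23 u)).1 2 = u.1 2 by [].
have : (exec_seq mask_start (tick 23 u)).1 4 = u.1 4 by [].
move: (exec_seq mask_start (tick 23 u)) => w w4 w2 [[w3 w6 w16 w24 wM] w5].
have := @carry_loop n k w; rewrite wM w3 v3 w24 v2 w6 w16.
have zf r : r \notin targets (Loop 24 (Block carry_step)) ->
  (sem (Loop 24 (Block carry_step)) w).1 r = w.1 r by apply: sem_frame.
move: (sem (Loop 24 (Block carry_step)) w)
  (zf 2 isT) (zf 3 isT) (zf 4 isT) (zf 5 isT) => z {zf}.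
rewrite w2 w3 w4 w5 v2 v3 v4 u5 addn1 => z2' z3 z4 z5.
case=> // zb zM.
have := mask_midE z; cbv zeta; rewrite z2' z3 z4 z5.
move: (exec_seq mask_mid z) => y.
case=> [[y20 y21 y22 y7 y6] [[y24 y2 y3 y4 y5] yM]].
have ztab : table n s q z.2.
  move=> j jn; have [<- <-] := utab j jn.
  by rewrite !zM // /A; apply/orP; left; lia.
have z2 : z.2 2 = p by rewrite zM // /A; apply/orP; left; lia.
have zD x : z.2 (D0 + x) = u.2 (D0 + x).
  by rewrite zM // /D0; apply/orP; right; lia.
have := @rows n s q y k.+1.
have tf r : r \notin targets (Loop 24 row) ->
  (sem (Loop 24 row) y).1 r = y.1 r by apply: sem_frame.
move: (sem (Loop 24 row) y) (tf 4 isT) (tf 5 isT) => t {tf}.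
rewrite y2 y3 y4 y5 y6 y7 y20 y21 y22 y24 yM => t4 t5.
case=> // t20 t21 t22 tM.
have [-> ->] := mask_endE t.
rewrite t20 t21 t22 tM t4 t5 z2.
set v := _ - _ - _.
have vE : v = dp_step n s q p (fun x => u.2 (D0 + x)) k.+1.
  rewrite /v /dp_step; congr (1 - (1 - _) - _ - _).
  by rewrite /preds; apply: eq_bigr => i _; rewrite zD.
have old x : x != D0 + k.+1 -> upd z.2 (D0 + k.+1) v x = z.2 x.
  by rewrite /upd => /negbTE ->.
have oldD x : x <= k -> upd z.2 (D0 + k.+1) v (D0 + x) = u.2 (D0 + x).
  by move=> xk; rewrite old ?zD // eqn_add2l; apply/eqP; lia.
split; split=> //.
- move=> j jn; have [<- <-] := ztab j jn.
  by rewrite !old // /D0 /A; apply/eqP; lia.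
- by move=> j jn; rewrite -zb // old // /D0 /A; apply/eqP; lia.
- by rewrite -[X in upd _ _ _ X]addn0 oldD // addn0.
move=> x /andP[x0]; rewrite leq_eqVlt => /orP[/eqP xk|xk].
  have new : upd z.2 (D0 + k.+1) v (D0 + k.+1) = v by rewrite /upd eqxx.
  rewrite xk new [LHS]vE; apply: dp_step_ext => // a ak.
  by cbv beta; rewrite oldD.
rewrite oldD // udp ?x0 //; apply: dp_step_ext => // a ak.
by cbv beta; rewrite oldD //; apply: ltnW (leq_trans ak xk).
Qed.

Lemma startE M (n := M 0) (st := exec_seq start (fun=> 0, M)) :
  [/\ st.1 2 = n, st.1 3 = 3 + n + n & st.1 4 = 3 + n + n + n] /\
  [/\ st.1 5 = 0, st.1 6 = n, st.1 23 = 1 & st.2 = upd M (3 + n + n + n) 1].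
Proof. by split; split; reflexivity. Qed.

Lemma doubling s : let s' := sem (Loop 6 (Block [:: Add 23 23 23])) s in
  s'.1 23 = s.1 23 * 2 ^ s.1 6 /\ s'.2 = s.2.
Proof.
have := @loop_ind 6 (Block [:: Add 23 23 23]) s
  (fun k u => u.1 23 = s.1 23 * 2 ^ k /\ u.2 = s.2).
apply => //; first by rewrite muln1.
move=> k u _ [u23 uM] _; split=> //.
have -> : forall v, (sem (Block [:: Add 23 23 23]) v).1 23 = v.1 23 + v.1 23 by [].
by rewrite expnS mulnCA mul2n -addnn -u23.
Qed.

Lemma algo_spec n s q p M : M 0 = n -> M 2 = p -> table n s q M ->
  (forall x, 3 + n + n <= x -> M x = 0) ->
  exists D : nat -> nat, [/\ D 0 = 1,
    forall x, 0 < x < 2 ^ n -> D x = dp_step n s q p D x &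
    (sem algo (fun=> 0, M)).1 0 = D (2 ^ n).-1].
Proof.
move=> M0 M2 tab Mz.
have -> : sem algo (fun=> 0, M) = exec_seq [:: Add 0 4 5; Fetch 0 0]
  (sem (Loop 23 mask) (exec_seq [:: Const 1 1; Sub 23 23 1]
  (sem (Loop 6 (Block [:: Add 23 23 23])) (exec_seq start (fun=> 0, M))))) by [].
have := startE M.
move: (exec_seq start (fun=> 0, M)) => w [[w2 w3 w4] [w5 w6 w23 wM]].
have [] := doubling w.
have zf r : r \notin targets (Loop 6 (Block [:: Add 23 23 23])) ->
  (sem (Loop 6 (Block [:: Add 23 23 23])) w).1 r = w.1 r by apply: sem_frame.
move: (sem (Loop 6 (Block [:: Add 23 23 23])) w)
  (zf 2 isT) (zf 3 isT) (zf 4 isT) (zf 5 isT) => z {zf}.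
rewrite w2 w3 w4 w5 w6 w23 wM M0 mul1n => z2 z3 z4 z5 z23 zM.
have yf r : r \notin [:: 1; 23] ->
    (exec_seq [:: Const 1 1; Sub 23 23 1] z).1 r = z.1 r.
  by move=> rr; rewrite exec_seq_frame.
have y23 : (exec_seq [:: Const 1 1; Sub 23 23 1] z).1 23 = (2 ^ n).-1.
  by rewrite -[LHS]/(z.1 23 - 1) z23 subn1.
have yM : (exec_seq [:: Const 1 1; Sub 23 23 1] z).2 =
  upd M (3 + n + n + n) 1 by [].
move: (exec_seq [:: Const 1 1; Sub 23 23 1] z) (yf 2 isT) (yf 3 isT) (yf 4 isT)
  (yf 5 isT) y23 yM => y {yf}; rewrite z2 z3 z4 z5 => y2 y3 y4 y5 y23 yM.
have old x : x != 3 + n + n + n -> y.2 x = M x.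
  by rewrite yM /upd => /negbTE ->.
have ytab : table n s q y.2.
  move=> j jn; have [<- <-] := tab j jn.
  by rewrite !old //; apply/eqP; lia.
(* Memory beyond the input is zero, which already encodes the bits of the empty mask. *)
have ybts : bits n (3 + n + n) (bit 0) y.2.
  move=> j jn; rewrite old ?Mz ?leq_addr //; last by apply/eqP; lia.
  by rewrite /bit div0n.
have yp : y.2 2 = p by rewrite old //; apply/eqP; lia.
have yD : y.2 (3 + n + n + n) = 1 by rewrite yM /upd eqxx.
have := @masks n s q p y _ ytab ybts yp yD y2 y3 y4 y5 y23.
have : (sem (Loop 23 mask) y).1 4 = y.1 4 by apply: sem_frame.
move: (sem (Loop 23 mask) y) => t; rewrite y4 => t4 [t5 tD tdp].
exists (fun x => t.2 (3 + n + n + n + x)); split.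
- by rewrite addn0.
- by move=> x /andP[x0 xn]; apply: tdp; rewrite x0 /=; lia.
by rewrite -[LHS]/(t.2 (t.1 4 + t.1 5)) t5 t4.
Qed.

(** * Running time *)

(** Per pair 31 instructions and 4 of loop control; 13 instructions on either side of the loop and 1
    for its exit test. *)
Lemma row_cost n s : s.1 2 = n -> cost row (tick 24 s) <= n * 35 + 27.
Proof.
move=> s2.
have -> : cost row (tick 24 s) = 13 + (cost (Loop 25 (Block pair_scan))
  (exec_seq row_start (tick 24 s)) + 13) by [].
have := @loop_cost 25 (Block pair_scan) (exec_seq row_start (tick 24 s))
  (fun=> True) 31 (fun _ _ => I) (fun _ _ => leqnn _) I.
have -> : (exec_seq row_start (tick 24 s)).1 25 = n by rewrite -s2.
by lia.
Qed.

Lemma mask_cost n s : s.1 2 = n ->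
  cost mask (tick 23 s) <= n * (n * 35 + 31) + n * 12 + 24.
Proof.
move=> s2; pose w := exec_seq mask_start (tick 23 s).
pose z := sem (Loop 24 (Block carry_step)) w.
have -> : cost mask (tick 23 s) = 5 + (cost (Loop 24 (Block carry_step)) w +
  (7 + (cost (Loop 24 row) (exec_seq mask_mid z) + 10))) by [].
have w2 : w.1 2 = n by rewrite -s2.
have w24 : w.1 24 = n by rewrite -s2.
have z2 : z.1 2 = n by rewrite -w2; apply: sem_frame.
pose y := exec_seq mask_mid z; rewrite -/y.
have y2 : y.1 2 = n by rewrite -z2.
have y24 : y.1 24 = n by rewrite -z2.
clearbody y; clear z2; clearbody w.
have row2 (u : store) : u.1 2 = n -> (sem row (tick 24 u)).1 2 = n.
  by move=> <-; rewrite sem_frame.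
have := @loop_cost 24 row y (fun u => u.1 2 = n) _ row2 (@row_cost n) y2.
have := @loop_cost 24 (Block carry_step) w (fun=> True) 8
  (fun _ _ => I) (fun _ _ => leqnn _) I.
by rewrite w24 y24; lia.
Qed.

Lemma algo_cost n M : M 0 = n ->
  cost algo (fun=> 0, M) <= 100 * (2 ^ n * n.+1 ^ 2).
Proof.
move=> M0; pose w := exec_seq start (fun=> 0, M).
pose z := sem (Loop 6 (Block [:: Add 23 23 23])) w.
pose y := exec_seq [:: Const 1 1; Sub 23 23 1] z.
have -> : cost algo (fun=> 0, M) =
  12 + (cost (Loop 6 (Block [:: Add 23 23 23])) w +
  (2 + (cost (Loop 23 mask) y + 2))) by [].
have w2 : w.1 2 = n by rewrite -M0.
have w6 : w.1 6 = n by rewrite -M0.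
have z2 : z.1 2 = n by rewrite -w2; apply: sem_frame.
have y2 : y.1 2 = n by rewrite -z2.
have y23 : y.1 23 = 2 ^ n - 1.
  rewrite -[LHS]/(z.1 23 - 1) /z; have [-> _] := doubling w.
  by rewrite w6 -[w.1 23]/1 mul1n.
clearbody y; clear z2; clearbody w.
have mask2 (u : store) : u.1 2 = n -> (sem mask (tick 23 u)).1 2 = n.
  by move=> <-; rewrite sem_frame.
have := @loop_cost 23 mask y (fun u => u.1 2 = n) _ mask2 (@mask_cost n) y2.
have := @loop_cost 6 (Block [:: Add 23 23 23]) w (fun=> True) 1
  (fun _ _ => I) (fun _ _ => leqnn _) I.
rewrite w6 y23 => H1 H2.
have p0 : 0 < 2 ^ n by rewrite expn_gt0.
have pn : n < 2 ^ n by apply: ltn_expl.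
move: p0 pn H1 H2; move: (2 ^ n) => N; rewrite -mulnn; nia.
Qed.

(** From [n = 1] on, each step multiplies the left by 2 and the right by at least 2. The factor 2 is
    for [n = 1, 2, 3], where the power exceeds the factorial. *)
Lemma exp2_fact n : 2 ^ n <= 2 * n`!.
Proof.
elim: n => // -[|n] // IHn; rewrite expnS factS mulnCA.
by apply: leq_mul.
Qed.

(** * Meaning of the arithmetic encodings *)

Lemma bit_sub m i j : bit m i -> bit (m - 2 ^ i) j = bit m j && (j != i).
Proof.
rewrite /bit => mi; have p0 k : 0 < 2 ^ k by rewrite expn_gt0.
have le : 2 ^ i <= m by rewrite -divn_gt0 //; case: (m %/ 2 ^ i) mi.
have mE : m = 2 ^ i + (m - 2 ^ i) by rewrite subnKC.
move: (m - 2 ^ i) mE mi => r -> {le m}.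
rewrite divnDl // divnn p0 oddD /= => ri.
(* Nothing is borrowed: below [i], the power is an even multiple of [2 ^ j]; above [i], adding 1 to
   the even quotient by [2 ^ i] leaves its half unchanged. *)
case: (ltngtP j i) => [ji|ij|->]; last by rewrite andbF (negbTE ri).
  rewrite andbT -{1}(subnK (ltnW ji)) expnD divnMDl // oddD oddX.
  by rewrite subn_eq0 leqNgt ji.
rewrite andbT -(subnKC (ltnW ij)) expnD !divnMA divnDl // divnn p0.
rewrite -(subnK (_ : 0 < j - i)) ?subn_gt0 // addn1 expnS !divnMA.
by rewrite !divn2 add1n /= uphalf_half (negbTE ri).
Qed.

Lemma all_bits0 n m : m < 2 ^ n -> (forall i, i < n -> ~~ bit m i) -> m = 0.
Proof.
case: m => // m mn H.
have /andP[l1 l2] := trunc_log_bounds (isT : 1 < 2) (isT : 0 < m.+1).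
have : trunc_log 2 m.+1 < n.
  by rewrite -(ltn_exp2l _ _ (isT : 1 < 2)); apply: leq_ltn_trans mn.
move/H; rewrite /bit.
suff -> : m.+1 %/ 2 ^ trunc_log 2 m.+1 = 1 by [].
by apply/eqP; rewrite eqn_leq -ltnS ltn_divLR ?expn_gt0 // -expnS l2 divn_gt0 ?expn_gt0.
Qed.

Lemma bit_ones n j : j < n -> bit (2 ^ n).-1 j.
Proof.
move=> jn; rewrite /bit.
have p0 k : 0 < 2 ^ k by rewrite expn_gt0.
have -> : (2 ^ n).-1 = (2 ^ (n - j)).-1 * 2 ^ j + (2 ^ j).-1.
  have {1}-> : 2 ^ n = 2 ^ (n - j) * 2 ^ j by rewrite -expnD subnK // ltnW.
  have := p0 (n - j); have := p0 j.
  by case: (2 ^ j) => // a _; case: (2 ^ (n - j)) => // b _; nia.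
rewrite divnMDl // divn_small ?prednK // addn0.
have : odd (2 ^ (n - j)) = false by rewrite oddX subn_eq0 leqNgt jn.
by have := p0 (n - j); case: (2 ^ (n - j)) => //= b _ /negbFE.
Qed.

Lemma later_eq0 n q i :
  reflect (forall j, j < n -> q i = q j -> j <= i) (later n q i == 0).
Proof.
rewrite /later sum_nat_eq0; apply: (iffP forallP) => [H j jn qij|H [j jn]] /=.
  by have := H (Ordinal jn); rewrite /= qij /dist; lia.
by have := H j jn; rewrite /dist; case: (q i =P q j) => [e /(_ e)|ne _]; lia.
Qed.

Lemma differ_eq0 n q b i :
  reflect (forall j, j < n -> q i = q j -> b i = b j) (differ n q b i == 0).
Proof.
rewrite /differ sum_nat_eq0; apply: (iffP forallP) => [H j jn qij|H [j jn]] /=.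
  by have := H (Ordinal jn); rewrite /= qij /dist; case: (b i); case: (b j); lia.
have := H j jn; rewrite /dist; case: (q i =P q j) => [e /(_ e) ->|ne _]; first lia.
by case: (b i); case: (b j); lia.
Qed.

Lemma disorder_eq0 n s (b : nat -> bool) :
  reflect (forall i j, i < n -> j < i -> s i = s j -> b i -> b j)
    (\sum_(i < n) disorder n s b i == 0).
Proof.
rewrite sum_nat_eq0; apply: (iffP forallP) => [H i j iN ji sij bi|H [i iN]] /=.
  have := H (Ordinal iN); rewrite /= /disorder sum_nat_eq0 => /forallP.
  move=> /(_ (Ordinal (ltn_trans ji iN))) /=.
  by rewrite sij bi /dist; case: (b j) => //; lia.
rewrite /disorder sum_nat_eq0; apply/forallP => -[j jN] /=.
have := H i j iN; rewrite /dist; case: (ltnP j i) => [ji /(_ isT)|]; last lia.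
case: (s i =P s j) => [e /(_ e)|ne _]; last by case: (b i); case: (b j); lia.
by case: (b i) => [/(_ isT)->|_]; lia.
Qed.

(** [undup] keeps the last occurrence of each value, which matches counting a pallet at its last
    bin. *)
Lemma count_undup (T : eqType) (x0 : T) (P : pred T) (s : seq T) :
  count P (undup s) =
  \sum_(i < size s) ((nth x0 s i \notin drop i.+1 s) && P (nth x0 s i)).
Proof.
elim: s => [|x s IHs]; first by rewrite big_ord0.
rewrite big_ord_recl /= drop0 -IHs.
by case: ifP => xs /=.
Qed.

Lemma openedE n q b : opened n q b =
  count (fun t => has (fun i => (q i == t) && b i) (iota 0 n) &&
                  has (fun i => (q i == t) && ~~ b i) (iota 0 n))
    (undup (mkseq q n)).
Proof.
rewrite (count_undup 0) size_mkseq /opened; apply: eq_bigr => i _.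
rewrite nth_mkseq //.
have -> : (q i \notin drop i.+1 (mkseq q n)) = (later n q i == 0).
  apply/idP/later_eq0 => [H j jn qij|H].
    rewrite leqNgt; apply: contra H => ij; rewrite qij.
    apply/(nthP 0); exists (j - i.+1).
      by rewrite size_drop size_mkseq; lia.
    by rewrite nth_drop subnKC // nth_mkseq.
  apply/negP => /(nthP 0)[j]; rewrite size_drop size_mkseq => jn.
  rewrite nth_drop nth_mkseq; last lia.
  by move=> /esym/H; lia.
(* Bin [i] can serve as one of the two witnesses: a pallet is open iff some bin of it differs from
   [i] in being removed. *)
set h := has _ _ && _; have -> : h = (0 < differ n q b i).
  rewrite lt0n; apply/idP/idP.
    case/andP=> /hasP[j]; rewrite mem_iota => jn /andP[/eqP qj bj].
    case/hasP=> l; rewrite mem_iota => ln /andP[/eqP ql bl].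
    apply: contraL bl => /differ_eq0 H; rewrite negbK.
    by rewrite -(H l) // (H j).
  apply: contraR => hF; apply/differ_eq0 => j jn qij.
  apply/eqP; apply: contraR hF => bij; rewrite /h.
  apply/andP; case bi: (b i) bij => bij; split; apply/hasP.
  - by exists (i : nat); rewrite ?mem_iota ?eqxx ?bi //=.
  - by exists j; rewrite ?mem_iota //= qij eqxx; case: (b j) bij.
  - by exists j; rewrite ?mem_iota //= qij eqxx; case: (b j) bij.
  - by exists (i : nat); rewrite ?mem_iota ?eqxx ?bi //=.
by case: (later n q i) => [|?]; case: (differ n q b i) => [|?]; rewrite /= ?subSS ?sub0n.
Qed.

Lemma dp_stepE n s q p D x : dp_step n s q p D x =
  [&& 0 < preds n D x, \sum_(i < n) disorder n s (bit x) i == 0 &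
      opened n q (bit x) <= p].
Proof.
rewrite /dp_step -[opened _ _ _ <= p]subn_eq0; move: (opened _ _ _ - p) => a.
by move: (preds _ _ _) (\sum_(_ < _) _) => b c; case: a b c => [|a] [|b] [|c] /=; lia.
Qed.

(** * Configurations as masks *)

Definition bin_row (I : instance) : nat -> nat :=
  reshape_index (shape (seqs I)).

Definition bin_rank (I : instance) : nat -> nat :=
  reshape_offset (shape (seqs I)).

Definition bin_plt (I : instance) : nat -> nat :=
  nth 0 (map (@plt I) (flatten (seqs I))).

(** The row is a plain number, as in the machine's table; the default 0 makes a bin in a row out of
    range count as not removed. *)
Definition removed (I : instance) (c : config I) (a : nat) : bool :=
  bin_rank I a < oapp c 0 (insub (bin_row I a)).

Lemma nbinsE I : nbins I = sumn (shape (seqs I)).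
Proof. exact: size_flatten. Qed.

Lemma bin_pltE I a :
  bin_plt I a = nth 0 (map (@plt I) (nth [::] (seqs I) (bin_row I a)))
    (bin_rank I a).
Proof.
have shE : shape (map (map (@plt I)) (seqs I)) = shape (seqs I).
  by rewrite /shape -map_comp; apply: eq_map => s /=; rewrite size_map.
rewrite /bin_plt map_flatten nth_flatten shE.
rewrite -[reshape_index _ a]/(bin_row I a).
case: (ltnP (bin_row I a) (size (seqs I))) => lt; first by rewrite (nth_map [::]).
by rewrite !nth_default ?size_map.
Qed.

Variant bin_spec (I : instance) (a : nat) : Prop :=
  BinSpec (j : 'I_(nseqs I)) of j = bin_row I a :> nat & bin_rank I a < size (@bseq I j) &
    (forall c : config I, removed c a = (bin_rank I a < c j)) &
    bin_plt I a = nth 0 (map (@plt I) (@bseq I j)) (bin_rank I a).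

Lemma binP I a : a < nbins I -> bin_spec I a.
Proof.
rewrite nbinsE => an.
have lt : bin_row I a < nseqs I.
  by have := reshape_indexP an; rewrite size_map.
have offP := reshape_offsetP an.
exists (Ordinal lt) => //.
- by move: offP; rewrite (nth_map [::]).
- by move=> c; rewrite /removed insubT.
- exact: bin_pltE.
Qed.

Lemma bin_at I (j : 'I_(nseqs I)) o : o < size (bseq j) ->
  exists2 a, a < nbins I & [/\ bin_row I a = j, bin_rank I a = o,
    bin_plt I a = nth 0 (map (@plt I) (bseq j)) o &
    forall c : config I, removed c a = (o < c j)].
Proof.
move=> oj; have lt : o < nth 0 (shape (seqs I)) j by rewrite (nth_map [::]).
pose a := flatten_index (shape (seqs I)) j o.
have rowE : bin_row I a = j by apply: flatten_indexKl.
have rankE : bin_rank I a = o by apply: flatten_indexKr.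
exists a; first by rewrite nbinsE flatten_indexP.
split=> //; first by rewrite bin_pltE rowE rankE.
by move=> c; rewrite /removed rowE rankE valK.
Qed.

Lemma bin_inj I a a' : bin_row I a = bin_row I a' ->
  bin_rank I a = bin_rank I a' -> a = a'.
Proof.
move=> r o; rewrite -[a](reshape_indexK (shape (seqs I))).
by rewrite -[a'](reshape_indexK (shape (seqs I))) -/(bin_row I a) r -/(bin_rank I a) o.
Qed.

Lemma bin_rank_mono I a a' : a <= a' -> bin_row I a = bin_row I a' ->
  bin_rank I a <= bin_rank I a'.
Proof.
by move=> le r; rewrite /bin_rank /reshape_offset -!/(bin_row I _) r leq_sub2r.
Qed.

Lemma bin_rank_lt I a a' : a < a' -> bin_row I a = bin_row I a' ->
  bin_rank I a < bin_rank I a'.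
Proof.
move=> lt r; rewrite ltn_neqAle bin_rank_mono // 1?ltnW // andbT.
by apply: contraTneq lt => /(bin_inj r) ->; rewrite ltnn.
Qed.

Lemma is_openE I (c : config I) t : is_open c t =
  has (fun a => (bin_plt I a == t) && removed c a) (iota 0 (nbins I)) &&
  has (fun a => (bin_plt I a == t) && ~~ removed c a) (iota 0 (nbins I)).
Proof.
have hasE (s : seq (bin I)) : has (fun b => plt b == t) s = (t \in map (@plt I) s) by
  rewrite -has_pred1 has_map.
apply/existsP/andP => [[j /existsP[l /andP[]]]|[]].
  rewrite !hasE => /(nthP 0)[o]; rewrite size_map size_take_min ltn_min.
  case/andP=> oc os; rewrite map_take nth_take // => ot.
  case/(nthP 0)=> o'; rewrite size_map size_drop map_drop nth_drop => lt ot'.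
  have [a an [_ _ qa ra]] := bin_at os.
  have [|a' an' [_ _ qa' ra']] := @bin_at I l (c l + o'); first by lia.
  split; apply/hasP; [exists a|exists a']; rewrite ?mem_iota //=.
    by rewrite qa ot eqxx ra.
  by rewrite qa' ot' eqxx ra' -leqNgt leq_addr.
case/hasP=> a; rewrite mem_iota => /= an /andP[/eqP qa ra].
case/hasP=> a'; rewrite mem_iota => /= an' /andP[/eqP qa' ra'].
have [j _ os remj pj] := binP an; have [l _ os' reml pl] := binP an'.
exists j; apply/existsP; exists l; rewrite !hasE.
rewrite remj in ra; rewrite reml -leqNgt in ra'.
apply/andP; split; apply/(nthP 0).
  exists (bin_rank I a); first by rewrite size_map size_take_min ltn_min ra.
  by rewrite map_take nth_take // -pj.
exists (bin_rank I a' - c l); first by rewrite size_map size_drop; lia.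
by rewrite map_drop nth_drop subnKC // -pl.
Qed.

Lemma num_openE I (c : config I) (b : nat -> bool) :
  (forall a, a < nbins I -> b a = removed c a) ->
  num_open c = opened (nbins I) (bin_plt I) b.
Proof.
move=> bE; rewrite openedE /num_open /pallets.
have -> : mkseq (bin_plt I) (nbins I) = map (@plt I) (flatten (seqs I)).
  by rewrite /bin_plt /nbins -(size_map (@plt I)) mkseq_nth.
apply: eq_count => t; rewrite is_openE.
by congr (_ && _); apply: eq_in_has => a; rewrite mem_iota => /bE ->.
Qed.

Lemma removed_order I (c : config I) a a' : a' < nbins I -> a < a' ->
  bin_row I a' = bin_row I a -> removed c a' -> removed c a.
Proof.
by move=> an lt r; rewrite /removed r; apply/ltn_trans/bin_rank_lt.
Qed.

Lemma removed_step I (c : config I) (j : 'I_(nseqs I)) a x :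
  bin_row I a = j -> bin_rank I a = c j -> x < nbins I ->
  removed [ffun l => if l == j then (c l).+1 else c l] x =
  removed c x || (x == a).
Proof.
move=> rowa ranka xn.
have [l lrow _ remx _] := binP xn; rewrite !remx ffunE.
case: eqP => [lj|lj].
  rewrite lj -ranka ltnS leq_eqVlt orbC; congr (_ || _).
  by apply/eqP/eqP => [|->//]; apply: bin_inj; rewrite rowa -lj.
suff /negbTE -> : x != a by rewrite orbF.
by apply/eqP => xa; apply/lj/ord_inj; rewrite lrow xa.
Qed.

Lemma transformE I (c c' : config I) : transform c c' ->
  exists2 a, a < nbins I & ~~ removed c a /\
    forall x, x < nbins I -> removed c' x = removed c x || (x == a).
Proof.
case/existsP=> j /andP[cj /eqP ->]; have [a an [rowa ranka _ ra]] := bin_at cj.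
exists a => //; rewrite ra ltnn; split=> // x; exact: removed_step.
Qed.

(** * Correctness of the recurrence over masks *)

Lemma preds_gt0 n D x : (forall y, y < 2 ^ n -> D y <= 1) -> x < 2 ^ n ->
  reflect (exists2 i, i < n & bit x i && (0 < D (x - 2 ^ i)))
    (0 < preds n D x).
Proof.
move=> D1 xn; rewrite lt0n sum_nat_eq0 negb_forall /=.
have le i : D (x - 2 ^ i) <= 1.
  by apply: D1; apply: leq_ltn_trans xn; apply: leq_subr.
apply: (iffP existsP) => [[[i iN] /= H]|[i iN /andP[xi Di]]].
  by exists i => //; move: H (le i); case: (bit x i) => /=; lia.
by exists (Ordinal iN); rewrite /= xi /= subn0 -lt0n.
Qed.

Definition dp_table (I : instance) (D : nat -> nat) : Prop :=
  D 0 = 1 /\ forall x, 0 < x < 2 ^ nbins I ->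
    D x = dp_step (nbins I) (bin_row I) (bin_plt I) (places I) D x.

Lemma dp_table_le1 I D m : dp_table I D -> m < 2 ^ nbins I -> D m <= 1.
Proof.
case=> D0 rec; case: m => [|m] mn; first by rewrite D0.
by rewrite rec // dp_stepE leq_b1.
Qed.

(** Induction from the end of the path: the bin removed by the last step is the bit to drop. The
    claim must cover prefixes of a processing, so the path may end anywhere. *)
Lemma dp_complete I D (s : seq (config I)) : dp_table I D ->
  path (@transform I) (init_config I) s ->
  (forall c, c \in init_config I :: s -> num_open c <= places I) ->
  forall m, m < 2 ^ nbins I ->
    (forall a, a < nbins I -> bit m a = removed (last (init_config I) s) a) ->
    0 < D m.
Proof.
move=> dpD; have [D0 rec] := dpD.
elim/last_ind: s => [|s c' IHs] /= => [_ _ m mn H|].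
  rewrite (all_bits0 mn) ?D0 // => i /[dup] iN /H ->.
  by have [j _ _ -> _] := binP iN; rewrite ffunE.
rewrite rcons_path => /andP[ps tr] op m mn; rewrite last_rcons => H.
have [a an [na rE]] := transformE tr.
have ma : bit m a by rewrite H // rE // eqxx orbT.
have m0 : 0 < m by case: (m) ma => //; rewrite /bit div0n.
rewrite rec ?m0 // dp_stepE lt0b; apply/and3P; split.
- apply/preds_gt0 => //; first by move=> y; apply: dp_table_le1.
  exists a => //; rewrite ma /=; apply: IHs => //.
  + by move=> c cs; apply: op; rewrite -rcons_cons mem_rcons inE cs orbT.
  + by apply: leq_ltn_trans mn; apply: leq_subr.
  move=> x xn; rewrite bit_sub // H // rE //.
  by case: eqP => [->|_]; rewrite ?andbF ?(negbTE na) // orbF andbT.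
- apply/disorder_eq0 => i j iN ji sij; rewrite !H //; last exact: ltn_trans iN.
  exact: removed_order.
rewrite -(num_openE H); apply: op.
by rewrite -rcons_cons mem_rcons inE eqxx.
Qed.

(** The recurrence never tests the empty mask; this covers it. *)
Lemma num_open_init I : num_open (init_config I) = 0.
Proof.
apply/eqP; rewrite -leqn0 leqNgt -has_count; apply/hasP => -[t _].
rewrite is_openE => /andP[/hasP[a]]; rewrite mem_iota => an /andP[_].
by have [j _ _ -> _] := binP an; rewrite ffunE.
Qed.

(** The bound on [c j] is recorded because the type of configurations does not impose it; for the
    full mask it forces the final configuration. *)
Lemma dp_sound I D m : dp_table I D -> m < 2 ^ nbins I -> 0 < D m ->
  exists s : seq (config I), let c := last (init_config I) s in
  [/\ path (@transform I) (init_config I) s,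
      forall c, c \in init_config I :: s -> num_open c <= places I,
      forall j, c j <= size (bseq j) &
      forall a, a < nbins I -> bit m a = removed c a].
Proof.
move=> dpD; have [D0 rec] := dpD.
elim/ltn_ind: m => m IHm mn; have [->|m0] := posnP m => [_|].
  exists [::]; split=> //= [c|j|a an].
  - by rewrite inE => /eqP ->; rewrite num_open_init.
  - by rewrite ffunE.
  - by have [j _ _ -> _] := binP an; rewrite ffunE /bit div0n.
rewrite rec ?m0 // dp_stepE lt0b => /and3P[/preds_gt0].
case=> // [y|i iN /andP[mi Di]]; first exact: dp_table_le1.
move=> /disorder_eq0 ord op.
have lt : m - 2 ^ i < m by rewrite ltn_subrL expn_gt0.
have [s [ps ops le bE]] := IHm _ lt (ltn_trans lt mn) Di.
set c := last _ s in le bE.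
have [j rowj rankj remj _] := binP iN.
have nri : ~~ removed c i by rewrite -bE // bit_sub // eqxx andbF.
(* Bin [i] is not removed in [c], so its rank is at least [c j]. Were it larger, the bin at position
   [c j] would precede [i], hence lie in [m] by closure and also in the smaller mask, although [c]
   has not removed it. *)
have cj : bin_rank I i = c j.
  apply/eqP; rewrite eqn_leq andbC leqNgt -remj nri /= leqNgt.
  apply/negP => lti.
  have [a an [rowa ranka _ ra]] := bin_at (ltn_trans lti rankj).
  have ai : a < i.
    rewrite ltnNge; apply/negP => /(@bin_rank_mono I); rewrite rowa rowj ranka.
    by move=> /(_ erefl); rewrite leqNgt lti.
  have := ord i a iN ai; rewrite rowa rowj => /(_ erefl mi) ma.
  have := bE a an; rewrite ra ltnn bit_sub // ma /=.
  by rewrite neq_ltn ai.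
pose c' : config I := [ffun l => if l == j then (c l).+1 else c l].
have tr : transform c c'.
  by apply/existsP; exists j; rewrite -cj rankj eqxx.
have bE' a : a < nbins I -> bit m a = removed c' a.
  move=> an; rewrite (removed_step _ cj) // -bE // bit_sub //.
  by case: eqP => [->|]; rewrite ?mi ?orbT // orbF andbT.
exists (rcons s c'); rewrite last_rcons rcons_path ps; split=> // [d|l].
  rewrite -rcons_cons mem_rcons inE => /predU1P[->|/ops//].
  by rewrite (num_openE bE').
by rewrite ffunE; case: eqP => [->|//]; rewrite -cj.
Qed.

Lemma dp_correct I D : dp_table I D ->
  0 < D (2 ^ nbins I).-1 <-> fifo_stack_up I.
Proof.
move=> dpD; have lt : (2 ^ nbins I).-1 < 2 ^ nbins I by rewrite prednK // expn_gt0.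
split=> [Dn|[s [[ps ls] ops]]].
  have [s [ps ops le bE]] := dp_sound dpD lt Dn.
  exists s; split=> //; split=> //; apply/ffunP => j; rewrite ffunE.
  apply/eqP; rewrite eqn_leq le leqNgt; apply/negP => ltj.
  have [a an [_ _ _ ra]] := bin_at ltj.
  by have := bE a an; rewrite ra ltnn bit_ones.
apply: (dp_complete dpD ps ops lt) => a an; rewrite bit_ones // ls.
by have [j _ lej -> _] := binP an; rewrite ffunE lej.
Qed.

(** * The encoded input as a table of bins *)

Lemma nth_flatten_pairs (s : seq (nat * nat)) a : a < size s ->
  nth 0 (flatten [seq [:: x.1; x.2] | x <- s]) (a + a) = (nth (0, 0) s a).1 /\
  nth 0 (flatten [seq [:: x.1; x.2] | x <- s]) (a + a + 1) =
    (nth (0, 0) s a).2.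
Proof.
elim: s a => // x s IHs [|a] lt //.
have -> : a.+1 + a.+1 = (a + a).+2 by lia.
exact: IHs.
Qed.

Lemma encodeE I : [/\ nth 0 (encode I) 0 = nbins I,
  nth 0 (encode I) 2 = places I,
  table (nbins I) (bin_row I) (bin_plt I) (nth 0 (encode I)) &
  size (encode I) = 3 + nbins I + nbins I].
Proof.
pose F (j : 'I_(nseqs I)) := [seq (nat_of_ord j, plt b) | b <- bseq j].
pose L := flatten (map F (enum 'I_(nseqs I))).
have encL : encode I =
    [:: nbins I; nseqs I; places I] ++ flatten [seq [:: x.1; x.2] | x <- L].
  rewrite /encode /L map_flatten -map_comp; congr (_ ++ flatten (flatten _)).
  by apply: eq_map => j /=; rewrite /F -map_comp.
have shE : shape (map F (enum 'I_(nseqs I))) = shape (seqs I).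
  rewrite -[RHS](mkseq_nth 0) size_map /mkseq -val_enum_ord /shape -!map_comp.
  by apply: eq_map => j /=; rewrite size_map (nth_map [::]).
have szL : size L = nbins I by rewrite size_flatten shE nbinsE.
have LE a : a < nbins I -> nth (0, 0) L a = (bin_row I a, bin_plt I a).
  move=> an; have [j rowj rankj _ ->] := binP an.
  rewrite nth_flatten shE -/(bin_row I a) -/(bin_rank I a) -rowj.
  have jk : j < size (enum 'I_(nseqs I)) by rewrite size_enum_ord.
  rewrite (nth_map j) // nth_ord_enum /F.
  (* A default bin for [nth]: sequence [j] is nonempty, as [bin_rank I a] is a position in it. *)
  have [b0 _] : exists b0 : bin I, true.
    by case: (bseq j) rankj => // b0 *; exists b0.
  by rewrite !(nth_map b0).
split; rewrite encL //.
- move=> a an; have := @nth_flatten_pairs L a; rewrite szL LE // => /(_ an).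
  by rewrite -!addnA !addSn.
- rewrite size_cat size_flatten /shape -map_comp.
  have -> : map (size \o (fun x : nat * nat => [:: x.1; x.2])) L = nseq (nbins I) 2.
    by rewrite -szL; elim: (L) => //= x s ->.
  by rewrite sumn_nseq /=; lia.
Qed.

(** * The decision procedure and its two time bounds *)

Lemma algo_decides (T : instance -> nat) :
  (forall I, 100 * (2 ^ nbins I * (nbins I).+1 ^ 2) <= T I) ->
  decides_within encode fifo_stack_up (rcons (compile 0 algo) Halt) T.
Proof.
move=> le_T I; have [e0 e2 tab sz] := encodeE I.
have [|D [D0 rec out]] := algo_spec e0 e2 tab.
  by move=> x nx; rewrite nth_default // sz.
have dpD : dp_table I D by split.
exists (0 < D (2 ^ nbins I).-1); split; first exact: dp_correct dpD.
have lt : (2 ^ nbins I).-1 < 2 ^ nbins I by rewrite prednK // expn_gt0.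
have -> : nat_of_bool (0 < D (2 ^ nbins I).-1) = D (2 ^ nbins I).-1.
  by have := dp_table_le1 dpD lt; case: (D _) => [|[]].
rewrite -out; apply: outputs_compile => //.
exact: leq_trans (algo_cost e0) (le_T I).
Qed.

(** Three doublings per round multiply by 8, as the machine cannot multiply. *)
Definition pow8 : cmd :=
  Seq (Block [:: Const 2 0; Fetch 2 2; Const 0 100])
    (Loop 2 (Block [:: Add 0 0 0; Add 0 0 0; Add 0 0 0])).

Lemma pow8_computable : computable (fun n => 100 * 8 ^ n).
Proof.
exists (rcons (compile 0 pow8) Halt) => n.
pose s : store := (fun=> 0, fun i => nth 0 [:: n] i).
exists (cost pow8 s); suff <- : (sem pow8 s).1 0 = 100 * 8 ^ n.
  exact: outputs_compile.
pose w := exec_seq [:: Const 2 0; Fetch 2 2; Const 0 100] s.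
have -> : sem pow8 s =
  sem (Loop 2 (Block [:: Add 0 0 0; Add 0 0 0; Add 0 0 0])) w by [].
have w0 : w.1 0 = 100 by [].
have w2 : w.1 2 = n by [].
clearbody w; rewrite -w2.
apply: (@loop_ind _ _ w (fun k u => u.1 0 = 100 * 8 ^ k)) => //.
move=> k u _ u0 _; rewrite expnS mulnCA -u0.
rewrite -[LHS]/(u.1 0 + u.1 0 + (u.1 0 + u.1 0) +
  (u.1 0 + u.1 0 + (u.1 0 + u.1 0))); lia.
Qed.

Theorem theorem12 :
  (exists (P : program) (T : instance -> nat),
     decides_within encode fifo_stack_up P T /\
     exists C : nat, forall I : instance, 0 < nbins I ->
       T I <= C * ((nbins I)`! * nbins I ^ 2)) /\
  fixed_parameter_tractable encode fifo_stack_up nbins.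
Proof.
split; exists (rcons (compile 0 algo) Halt).
  exists (fun I => 100 * (2 ^ nbins I * (nbins I).+1 ^ 2)).
  split; first exact: algo_decides.
  (* 800 is 100 * 2 * 4, with 2 from [exp2_fact] and 4 from squaring [n + 1 <= 2 * n] for positive
     [n]. *)
  exists 800 => I n0; have := exp2_fact (nbins I).
  have : (nbins I).+1 ^ 2 <= 4 * nbins I ^ 2 by rewrite -!mulnn; nia.
  move: (2 ^ _) (_`!) (_ ^ 2) (_ ^ 2) => a b c d; nia.
(* Exponent 0, because the time bound depends on the number of bins alone. *)
exists (fun n => 100 * 8 ^ n), 0; split; first exact: pow8_computable.
apply: algo_decides => I; rewrite expn0 muln1 leq_mul2l /=.
(* Since [n + 1 <= 2 ^ n], the factor [n.+1 ^ 2] is at most [4 ^ n]. *)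
rewrite -[8]/(2 * 2 ^ 2) expnMn leq_mul2l -expnM mulnC expnM.
by rewrite leq_exp2r // ltn_expl // orbT.
Qed.
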